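(* Let $X_Q=V(r^2-qs)\subset\mathbb{C}^4$ and for $d\in\mathbb{N}$ let $g_d:X_Q\to X_Q$ be the Chebyshev-induced morphism on $\mathbb{C}^3/D_4\simeq X_Q$. Let $S_P=V(p^2-s,\ qs-r^2)$ and let $G_P:\mathbb{C}^2\to\mathbb{C}^4$, $G_P(w,t)=\bigl((w+t)^2,\ (wt+2)^2,\ (w+t)^2(wt+2),\ (w+t)^4\bigr)$. (1) $g_d(G_P(w,t))=G_P(T_d(w),T_d(t))$ for all $w,t\in\mathbb{C}$ and $d\in\mathbb{N}$. (2) $g_d(S_P)=S_P$ for all $d\in\mathbb{N}$. (3) For $d\ge2$, $K(g_d|_{S_P})=\{G_P(2\cos\alpha,2\cos\beta):0\le\alpha,\beta\le2\pi\}$.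
   Context: $\mathbb{N}=\{1,2,\dots\}$. $T_d(z)$ is the one-variable Chebyshev polynomial with $T_d(s+s^{-1})=s^d+s^{-d}$. Definition of $g_d$: the Chebyshev endomorphism $P_{A_3}^d:\mathbb{C}^3\to\mathbb{C}^3$ is defined by $P_{A_3}^d(e_1(t),e_2(t),e_3(t))=(e_1(t^d),e_2(t^d),e_3(t^d))$ for $t=(t_1,t_2,t_3,t_4)\in(\mathbb{C}^* )^4$ with $t_1t_2t_3t_4=1$, where $t^d=(t_1^d,\dots,t_4^d)$ and $e_j$ is the $j$-th elementary symmetric polynomial. With $M_3(x,y,z)=(x+iy,\,z,\,x-iy)$ put $f_d=M_3^{-1}\circ P_{A_3}^d\circ M_3$. $D_4\subset GL(3,\mathbb{R})$ is the dihedral group of order 8 generated by $(x,y,z)\mapsto(-y,x,-z)$ and $(x,y,z)\mapsto(x,-y,z)$. The map $\tilde F(x,y,z)=(x^2+y^2,\,z^2,\,z(x^2-y^2),\,(x^2-y^2)^2)$ from $\mathbb{C}^3$ onto $X_Q$ (coordinates $(p,q,r,s)$) induces a bijection $\mathbb{C}^3/D_4\simeq X_Q$, and $g_d:X_Q\to X_Q$ is the unique map with $g_d\circ\tilde F=\tilde F\circ f_d$ (it is a morphism). For a $g_d$-invariant subvariety $V\subset X_Q$, $K(g_d|_V)$ is the set of $w\in V$ whose forward orbit $\{g_d^k(w):k=1,2,\dots\}$ is bounded in $\mathbb{C}^4$. *)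

(* Defs.v *)
From HB Require Import structures.
From mathcomp Require Import all_boot all_order all_algebra.
From mathcomp Require Import complex.
From mathcomp Require Import all_classical all_reals all_analysis.
From mathcomp Require Import ring.

Set Implicit Arguments.
Unset Strict Implicit.
Unset Printing Implicit Defensive.

Import Order.TTheory GRing.Theory Num.Theory numFieldNormedType.Exports.

Local Open Scope classical_set_scope.
Local Open Scope ring_scope.

(* R[i] typed by its numClosedFieldType structure, so that products of copies
   of it inherit the (sup) norm of numFieldNormedType, used by [bounded_set]. *)
Definition Cplx (R : realType) : numClosedFieldType := R[i].

Definition toC (R : realType) (x : R) : Cplx R := (x%:C)%C.

Section Chebyshev1.
Variable R : realType.
Local Notation C := (Cplx R).

(* Normalized by T_d(s + s^-1) = s^d + s^-d; see chebyTP. *)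
Fixpoint chebyT (d : nat) : {poly C} :=
  match d with
  | 0 => 2%:R%:P
  | S d1 => match d1 with
            | 0 => 'X
            | S d2 => 'X * chebyT d1 - chebyT d2
            end
  end.

Lemma chebyTP (d : nat) (s : C) :
  s != 0 -> (chebyT d).[s + s^-1] = s ^+ d + s ^- d.
Proof.
move=> s0; suff: (chebyT d).[s + s^-1] = s ^+ d + s ^- d /\
  (chebyT d.+1).[s + s^-1] = s ^+ d.+1 + s ^- d.+1 by case.
elim: d => [|d [IH1 IH2]]; first by split; rewrite /= !hornerE ?expr0 ?invr1 ?expr1.
split=> //.
rewrite [chebyT d.+2]/(_ - _) -/(chebyT d.+1) -/(chebyT d).
rewrite hornerD hornerN hornerM hornerX IH1 IH2 !exprS.
by field; rewrite s0 expf_neq0.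
Qed.

End Chebyshev1.

Section ChebyshevA3.
Variable R : realType.
Local Notation C := (Cplx R).
Local Notation C3 := (C * C * C)%type.
Local Notation C4 := (C * C * C * C)%type.
Local Notation I := ('i : C).

Definition esym (j : nat) (t : {ffun 'I_4 -> C}) : C :=
  \sum_(A : {set 'I_4} | #|A| == j) \prod_(k in A) t k.

Definition esym3 (t : {ffun 'I_4 -> C}) : C3 := (esym 1 t, esym 2 t, esym 3 t).

Definition powt (d : nat) (t : {ffun 'I_4 -> C}) : {ffun 'I_4 -> C} :=
  [ffun k => t k ^+ d].

(* The preimage t is picked by choice: it exists by esym3_onto, and the value
   does not depend on it by P_A3E.  Note that \prod_k t k = 1 forces t k != 0. *)
Definition P_A3 (d : nat) (v : C3) : C3 :=
  esym3 (powt d (xget 0 [set t : {ffun 'I_4 -> C} | \prod_k t k = 1 /\ esym3 t = v])).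

Definition M3 (v : C3) : C3 :=
  let: (x, y, z) := v in (x + I * y, z, x - I * y).

Definition M3inv (v : C3) : C3 :=
  let: (a, b, c) := v in ((a + c) / 2%:R, (a - c) / (2%:R * I), b).

Definition f_map (d : nat) (v : C3) : C3 := M3inv (P_A3 d (M3 v)).

Definition rho (v : C3) : C3 := let: (x, y, z) := v in (- y, x, - z).

Definition sigma (v : C3) : C3 := let: (x, y, z) := v in (x, - y, z).

(* Orbits of the group D_4 generated by rho and sigma (both of finite order). *)
Inductive D4_orbit (v : C3) : C3 -> Prop :=
  | D4_id : D4_orbit v v
  | D4_rho u : D4_orbit v u -> D4_orbit v (rho u)
  | D4_sigma u : D4_orbit v u -> D4_orbit v (sigma u).

Definition X_Q : set C4 := [set w | let: (p, q, r, s) := w in r ^+ 2 = q * s].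

Definition F_tilde (v : C3) : C4 :=
  let: (x, y, z) := v in
  (x ^+ 2 + y ^+ 2, z ^+ 2, z * (x ^+ 2 - y ^+ 2), (x ^+ 2 - y ^+ 2) ^+ 2).

(* Only the values on X_Q = range F_tilde are meaningful.  There g_map d is the
   unique map with g_map d \o F_tilde = F_tilde \o f_map d: see g_map_F_tilde, g_map_unique. *)
Definition g_map (d : nat) (w : C4) : C4 :=
  F_tilde (f_map d (xget 0 (F_tilde @^-1` [set w]))).

Definition S_P : set C4 :=
  [set w | let: (p, q, r, s) := w in p ^+ 2 = s /\ q * s = r ^+ 2].

Definition G_P (w t : C) : C4 :=
  ((w + t) ^+ 2, (w * t + 2%:R) ^+ 2,
   (w + t) ^+ 2 * (w * t + 2%:R), (w + t) ^+ 4).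

Definition K_set (h : C4 -> C4) (V : set C4) : set C4 :=
  [set w : C4 | V w /\ bounded_set [set iter k h w | k in [set k | (0 < k)%N]]].

Lemma M3K : cancel M3 M3inv.
Proof.
move=> [[x y] z] /=; congr (_, _, _); field; rewrite ?neq0Ci //.
Qed.

Lemma M3invK : cancel M3inv M3.
Proof.
move=> [[x y] z] /=; congr (_, _, _); field; rewrite ?neq0Ci //.
Qed.

Definition rootp (t : {ffun 'I_4 -> C}) : {poly C} := \prod_k ('X + (t k)%:P).

Lemma esym_coef j t : (j <= 4)%N -> esym j t = (rootp t)`_(4 - j).
Proof.
move=> j4; rewrite /rootp; under eq_bigr do rewrite addrC.
rewrite bigA_distr coef_sum /esym [LHS]big_mkcond /=.
apply: eq_bigr => A _.
rewrite (eq_bigr (fun k => (if k \in A then t k else 1)%:P *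
                           (if k \in A then 1 else 'X))); last first.
  by move=> k _; case: ifP; rewrite ?mulr1 ?mul1r.
rewrite big_split /= -rmorph_prod coefCM -big_mkcond /=.
have -> : \prod_(k < 4) (if k \in A then 1 else 'X) = 'X^(4 - #|A|) :> {poly C}.
  rewrite (eq_bigr (fun k => if k \in ~: A then 'X else 1)); last first.
    by move=> k _; rewrite inE; case: (k \in A).
  by rewrite -big_mkcond prodr_const cardsCs finset.setCK card_ord.
have A4 : (#|A| <= 4)%N by rewrite -[X in (_ <= X)%N](card_ord 4) max_card.
rewrite coefXn eq_sym.
have -> : (j == #|A|) = (4 - j == 4 - #|A|)%N.
  by apply/eqP/eqP => [->//|/(congr1 (subn 4))]; rewrite !subKn.
by case: eqP; rewrite ?mulr1 ?mulr0.
Qed.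

Lemma esym0 t : esym 0 t = 1.
Proof.
rewrite /esym (big_pred1 finset.set0) ?finset.big_set0 // => A /=.
by rewrite cards_eq0.
Qed.

Lemma esym4 (t : {ffun 'I_4 -> C}) : esym 4 t = \prod_k t k.
Proof.
rewrite /esym (big_pred1 [set: _]%SET); first by apply: eq_bigl => k; rewrite inE.
move=> A /=; rewrite -[X in _ == X](card_ord 4) -cardsT.
by rewrite eqEcard finset.subsetT /= eqn_leq subset_leq_card ?finset.subsetT.
Qed.

Lemma rootpE t : rootp t = \prod_(x <- codom t) ('X - (- x)%:P).
Proof.
rewrite /rootp codomE big_map big_enum /=.
by apply: eq_bigr => k _; rewrite polyCN opprK.
Qed.

Lemma size_rootp t : size (rootp t) = 5.
Proof.
rewrite rootpE -(big_map -%R predT (fun x => 'X - x%:P)).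
by rewrite size_prod_XsubC size_map size_codom card_ord.
Qed.

Lemma rootp_inj (t u : {ffun 'I_4 -> C}) : \prod_k t k = 1 -> \prod_k u k = 1 ->
  esym3 t = esym3 u -> rootp t = rootp u.
Proof.
move=> t1 u1 [e1 e2 e3]; apply/polyP => k.
have [k5|k5] := leqP 5 k; first by rewrite !nth_default ?size_rootp.
rewrite -[k](@subKn k 4) // -!esym_coef ?leq_subr //.
case: k k5 => [|[|[|[|[|k]]]]] // _ /=; rewrite ?esym0 //.
by rewrite !esym4 t1 u1.
Qed.

Lemma esym3_onto (v : C3) :
  exists t : {ffun 'I_4 -> C}, \prod_k t k = 1 /\ esym3 t = v.
Proof.
case: v => [[a b] c].
pose p : {poly C} := Poly [:: 1; c; b; a; 1].
have ps : p = [:: 1; c; b; a; 1] :> seq C by rewrite (@PolyK _ 0) //= oner_eq0.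
have [r pr] := closed_field_poly_normal p.
have pl : lead_coef p = 1 by rewrite /lead_coef ps.
rewrite pl scale1r in pr.
have sr : size r = 4 by have := size_prod_XsubC r id; rewrite -pr ps => -[].
pose t := [ffun k : 'I_4 => - r`_k].
have pt : rootp t = p.
  rewrite pr (big_nth 0) sr big_mkord; apply: eq_bigr => k _.
  by rewrite ffunE polyCN.
exists t; rewrite -esym4 esym_coef // pt ps; split=> //.
by rewrite /esym3 !esym_coef // pt ps.
Qed.

Lemma esym3_powt d (t u : {ffun 'I_4 -> C}) : \prod_k t k = 1 -> \prod_k u k = 1 ->
  esym3 t = esym3 u -> esym3 (powt d t) = esym3 (powt d u).
Proof.
move=> t1 u1 tu; have := rootp_inj t1 u1 tu.
rewrite !rootpE -!(big_map -%R predT (fun x => 'X - x%:P)) => /prod_XsubC_eq.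
move=> /(perm_map_inj (@oppr_inj _)) ptu.
suff E : rootp (powt d t) = rootp (powt d u) by rewrite /esym3 !esym_coef ?E.
have H w : rootp (powt d w) = \prod_(x <- codom w) ('X + (x ^+ d)%:P).
  rewrite /rootp codomE big_map big_enum /=.
  by apply: eq_bigr => k _; rewrite ffunE.
by rewrite !H (perm_big _ ptu).
Qed.

Lemma P_A3E (d : nat) (t : {ffun 'I_4 -> C}) :
  \prod_k t k = 1 -> P_A3 d (esym3 t) = esym3 (powt d t).
Proof.
move=> t1; rewrite /P_A3; case: xgetP => [u _ [u1 ut]|/(_ t) []//].
exact: esym3_powt.
Qed.

Lemma F_tilde_onto : range F_tilde = X_Q.
Proof.
apply/seteqP; split=> [_ [[[x y] z] _ <-] /=|]; first by ring.
move=> [[[p q] r] s] /= E.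
have [z zq] : exists z : C, z ^+ 2 = q by exists (sqrtC q); rewrite sqrtCK.
have [u us ur] : exists2 u : C, u ^+ 2 = s & z * u = r.
  have [q0|q0] := eqVneq q 0.
    exists (sqrtC s); first by rewrite sqrtCK.
    move/eqP: E; rewrite q0 mul0r expf_eq0 /= => /eqP ->.
    by move/eqP: zq; rewrite q0 expf_eq0 /= => /eqP ->; rewrite mul0r.
  have z0 : z != 0 by apply: contraNneq q0 => z0; rewrite -zq z0 expr0n.
  exists (r / z); last by rewrite mulrC divfK.
  by rewrite expr_div_n E -zq mulrC mulKf // expf_neq0.
exists (sqrtC ((p + u) / 2), sqrtC ((p - u) / 2), z) => //=.
by rewrite !sqrtCK -us -ur -zq; congr (_, _, _, _); field.
Qed.

(* F_tilde in the coordinates (a, b, c) = M3 (x, y, z). *)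
Definition FM (v : C3) : C4 := let: (a, b, c) := v in
  (a * c, b ^+ 2, b * ((a ^+ 2 + c ^+ 2) / 2),
   ((a ^+ 2 + c ^+ 2) / 2) ^+ 2).

Lemma F_tildeE v : F_tilde (M3inv v) = FM v.
Proof.
have II : (I : C) ^+ 2 = -1 by rewrite sqrCi.
case: v => [[a b] c] /=.
have -> : ((a - c) / (2 * I)) ^+ 2 = - ((a - c) / 2) ^+ 2 :> C.
  by rewrite !expr_div_n exprMn II mulrN1 invrN mulrN.
by congr (_, _, _, _); field.
Qed.

Lemma D4_trans u v w : D4_orbit u v -> D4_orbit v w -> D4_orbit u w.
Proof. by move=> uv; elim=> // x _ ux; [apply: D4_rho|apply: D4_sigma]. Qed.

Lemma D4_square (x y z x' y' : C) : x ^+ 2 = x' ^+ 2 -> y ^+ 2 = y' ^+ 2 ->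
  D4_orbit (x, y, z) (x', y', z).
Proof.
move=> /eqP; rewrite eq_sym eqf_sqr => /orP[] /eqP ->.
- move=> /eqP; rewrite eq_sym eqf_sqr => /orP[] /eqP ->; first exact: D4_id.
  exact: D4_sigma (D4_id _).
- have H := D4_rho (D4_rho (D4_id (x, y, z))); rewrite /= opprK in H.
  move=> /eqP; rewrite eq_sym eqf_sqr => /orP[] /eqP -> //.
  by have := D4_sigma H; rewrite /= opprK.
Qed.

Lemma F_tilde_D4 (u v : C3) : F_tilde u = F_tilde v <-> D4_orbit u v.
Proof.
split=> [|]; last first.
  elim=> // -[[x y] z] _ -> /=; congr (_, _, _, _); ring.
case: u => [[x y] z]; case: v => [[x' y'] z'] [].
move=> E1 E2 E3 E4.
have half (a b a' b' : C) : a + b = a' + b' -> a - b = a' - b' ->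
    a = a' /\ b = b'.
  move=> h1 h2; have h : a * 2 = a' * 2.
    have -> : a * 2 = a + b + (a - b) by ring.
    by rewrite h1 h2; ring.
  have n2 : (2 : C) != 0 by rewrite pnatr_eq0.
  have aa := mulIf n2 h.
  by split=> //; move: h1; rewrite aa => /addrI.
have S1 : z = z' -> x ^+ 2 - y ^+ 2 = x' ^+ 2 - y' ^+ 2 ->
    D4_orbit (x, y, z) (x', y', z').
  by move=> -> h; have [] := half _ _ _ _ E1 h; exact: D4_square.
have S2 : z = - z' -> x ^+ 2 - y ^+ 2 = - (x' ^+ 2 - y' ^+ 2) ->
    D4_orbit (x, y, z) (x', y', z').
  rewrite opprB => -> h; have [h1 h2] := half _ _ _ _ (etrans E1 (addrC _ _)) h.
  apply: D4_trans (D4_rho (D4_id _)) _; rewrite /= opprK.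
  by apply: D4_square => //; rewrite sqrrN.
move/eqP: E2; rewrite eqf_sqr => /orP[] /eqP Z;
  move/eqP: E4; rewrite eqf_sqr => /orP[] /eqP D; [exact: S1| | |exact: S2].
- rewrite Z D mulrN in E3; move/eqP: E3; rewrite eq_sym -subr_eq0 opprK.
  rewrite -mulr2n mulrn_eq0 /= mulf_eq0 => /orP[] /eqP h.
    by apply: S2 => //; rewrite Z h oppr0.
  by apply: S1 => //; rewrite D h oppr0.
- rewrite Z D mulNr in E3; move/eqP: E3; rewrite eq_sym -subr_eq0 opprK.
  rewrite -mulr2n mulrn_eq0 /= mulf_eq0 => /orP[] /eqP h.
    by apply: S1 => //; rewrite Z h oppr0.
  by apply: S2 => //; rewrite D h oppr0.
Qed.

Lemma esym_scale j (c : C) (t : {ffun 'I_4 -> C}) : esym j [ffun k => c * t k] = c ^+ j * esym j t.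
Proof.
rewrite /esym big_distrr /=; apply: eq_bigr => A /eqP <-.
under eq_bigr do rewrite ffunE.
by rewrite big_split /= prodr_const.
Qed.

Lemma esym_inv j (t : {ffun 'I_4 -> C}) : (j <= 4)%N -> \prod_k t k = 1 ->
  esym j [ffun k => (t k)^-1] = esym (4 - j) t.
Proof.
move=> j4 t1; rewrite /esym (reindex_inj (inv_inj (@finset.setCK 'I_4))) /=.
apply: eq_big => [A|A _].
  have A4 : (#|A| <= 4)%N by rewrite -[X in (_ <= X)%N](card_ord 4) max_card.
  rewrite cardsCs finset.setCK card_ord; apply/eqP/eqP => [<-|->]; by rewrite subKn.
under eq_bigr do rewrite ffunE.
rewrite prodfV; apply: (@mulfI _ (\prod_(k in ~: A) t k)).
  apply/prodf_neq0 => k _; apply/eqP => tk.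
  by move/eqP: t1; rewrite (bigD1 k) //= tk mul0r eq_sym oner_eq0.
rewrite mulfV; last first.
  apply/prodf_neq0 => k _; apply/eqP => tk.
  by move/eqP: t1; rewrite (bigD1 k) //= tk mul0r eq_sym oner_eq0.
rewrite -[LHS]t1 (bigID (mem A)) /= mulrC; congr (_ * _).
by apply: eq_bigl => k; rewrite inE.
Qed.

Lemma g_wd d (u v : C3) : D4_orbit u v -> F_tilde (f_map d v) = F_tilde (f_map d u).
Proof.
elim=> // {}v _ <-; rewrite /f_map !F_tildeE;
  have [t [t1 tv]] := esym3_onto (M3 v).
- have -> : M3 (rho v) = esym3 [ffun k => I * t k].
    have I2 : (I : C) ^+ 2 = -1 by rewrite sqrCi.
    rewrite /esym3 !esym_scale.
    case: v tv => [[x y] z] /= [-> -> ->]; congr (_, _, _).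
    + by rewrite expr1 mulrDr mulrA -expr2 I2; ring.
    + by rewrite I2 mulN1r.
    + have -> : I ^+ 3 * (x - I * y) = I * I ^+ 2 * x - (I ^+ 2) ^+ 2 * y by ring.
      by rewrite I2; ring.
  have I4 : (I : C) ^+ 4 = 1 by rewrite (exprM _ 2 2) sqrCi sqrrN expr1n.
  rewrite P_A3E -?tv ?P_A3E //; last first.
    under eq_bigr do rewrite ffunE.
    by rewrite big_split /= prodr_const card_ord I4 t1 mulr1.
  have -> : powt d [ffun k => I * t k] = [ffun k => I ^+ d * powt d t k].
    by apply/ffunP => k; rewrite !ffunE exprMn.
  rewrite /esym3 !esym_scale; set e := _ ^+ d.
  have e4 : e ^+ 4 = 1 by rewrite /e -exprM mulnC exprM I4 expr1n.
  move: (esym 1 _) (esym 2 _) (esym 3 _) => a b c; rewrite /FM.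
  congr (_, _, _, _).
  + by rewrite -[RHS]mul1r -e4; ring.
  + by rewrite -[RHS]mul1r -e4; ring.
  + have -> : (e ^+ 3 * c) ^+ 2 = e ^+ 4 * e ^+ 2 * c ^+ 2 by ring.
    rewrite e4 mul1r.
    transitivity (e ^+ 4 * (b * ((a ^+ 2 + c ^+ 2) / 2))); first by ring.
    by rewrite e4 mul1r.
  + have -> : (e ^+ 3 * c) ^+ 2 = e ^+ 4 * e ^+ 2 * c ^+ 2 by ring.
    rewrite e4 mul1r.
    transitivity (e ^+ 4 * ((a ^+ 2 + c ^+ 2) / 2) ^+ 2); first by ring.
    by rewrite e4 mul1r.
- have -> : M3 (sigma v) = esym3 [ffun k => (t k)^-1].
    rewrite /esym3 !esym_inv //.
    by case: v tv => [[x y] z] /= [-> -> ->]; rewrite mulrN opprK.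
  rewrite P_A3E -?tv ?P_A3E //; last first.
    by under eq_bigr do rewrite ffunE; rewrite prodfV t1 invr1.
  have -> : powt d [ffun k => (t k)^-1] = [ffun k => (powt d t k)^-1].
    by apply/ffunP => k; rewrite !ffunE exprVn.
  have d1 : \prod_k powt d t k = 1.
    by under eq_bigr do rewrite ffunE; rewrite prodrXl t1 expr1n.
  rewrite /esym3 !esym_inv //= !subSS subn0.
  by congr (_, _, _, _); ring.
Qed.

Lemma g_map_F_tilde (d : nat) (v : C3) : g_map d (F_tilde v) = F_tilde (f_map d v).
Proof.
rewrite /g_map; case: xgetP => [u _ uv|/(_ v) []//].
by apply: g_wd; apply/F_tilde_D4.
Qed.

Lemma g_map_unique (d : nat) (h : C4 -> C4) :
  (forall v, h (F_tilde v) = F_tilde (f_map d v)) ->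
  forall w, X_Q w -> h w = g_map d w.
Proof.
by move=> hF w; rewrite -F_tilde_onto => -[v _ <-]; rewrite hF g_map_F_tilde.
Qed.

End ChebyshevA3.

Arguments X_Q R : clear implicits.
Arguments S_P R : clear implicits.

(* Main.v *)
(* G_P (a + 1/a) (b + 1/b) is the image in X_Q of the point with torus parameter
   (a, 1/a, b, 1/b), and f_d raises torus parameters to the d-th power: so g_d
   acts on S_P through T_d x T_d.  Every point of C^2 has the form
   (a + 1/a, b + 1/b) with |a|, |b| >= 1, and its orbit is bounded iff
   |a| = |b| = 1, i.e. iff both coordinates are 2 cos of a real angle. *)
Require Import Defs.
From mathcomp Require Import all_boot all_order all_algebra.
From mathcomp Require Import all_classical all_reals all_analysis.
From mathcomp Require Import complex ring.
Import Order.TTheory GRing.Theory Num.Theory.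
Local Open Scope classical_set_scope.
Local Open Scope ring_scope.

(** * Quadratic roots and growth estimates *)

Lemma quadratic_roots {F : numClosedFieldType} (u v : F) :
  exists x y, x + y = u /\ x * y = v.
Proof.
pose e := sqrtC (u ^+ 2 - 4 * v).
have e2 : e ^+ 2 = u ^+ 2 - 4 * v by rewrite sqrtCK.
exists ((u + e) / 2), ((u - e) / 2); split; first by field.
have -> : (u + e) / 2 * ((u - e) / 2) = (u ^+ 2 - e ^+ 2) / 4 by field.
by rewrite e2; field.
Qed.

(** The two roots of X^2 - w X + 1 have product 1, so one of them has modulus at least 1. Choosing
    that one leaves only modulus above 1 to be excluded for bounded orbits. *)
Lemma joukowsky_onto {F : numClosedFieldType} (w : F) :
  exists2 s, 1 <= `|s| & w = s + s^-1.
Proof.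
have [x [y [xy1 xy]]] := quadratic_roots w 1.
have nxy : `|x| * `|y| = 1 by rewrite -normrM xy normr1.
have inv (a b : F) : a * b = 1 -> b = a^-1.
  move=> ab; have a0 : a != 0.
    by apply: contra_eq_neq ab => ->; rewrite mul0r eq_sym oner_eq0.
  by apply: (mulfI a0); rewrite ab mulfV.
have [x1|/ltW x1] := real_leP (real1 F) (normr_real x).
  by exists x; rewrite // -xy1 {1}(inv _ _ xy).
exists y; last by rewrite -xy1 addrC {1}(inv y x) // mulrC.
by rewrite -nxy ler_piMl.
Qed.

(** When [|x| >= 1], divide the identity x^2 = x (x + y) - x y by [|x|]. This recovers bounds on two
    numbers from bounds on their sum and product. *)
Lemma quadratic_root_bound {F : numFieldType} (x y : F) :
  `|x| <= 1 + `|x + y| + `|x * y|.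
Proof.
have [x1|/ltW x1] := real_leP (normr_real x) (real1 F).
  by apply: (le_trans x1); rewrite -addrA lerDl addr_ge0.
have xx : `|x| * `|x| <= `|x| * (`|x + y| + `|x * y|).
  have -> : `|x| * `|x| = `|x * (x + y) - x * y|.
    by rewrite -normrM; congr (`|_|); ring.
  rewrite (le_trans (ler_normB _ _)) // [leRHS]mulrDr (normrM x (x + y)) lerD2l.
  exact: ler_peMl.
have := xx; rewrite ler_pM2l ?(lt_le_trans ltr01) // => /le_trans -> //.
by rewrite -addrA lerDr.
Qed.

Lemma norm_prod_le {K : numDomainType} {U V : normedZmodType K} (x : U * V) (M : K) :
  (`|x| <= M) = (`|x.1| <= M) && (`|x.2| <= M).
Proof. by rewrite prod_normE comparable_ge_max // real_comparable. Qed.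

(** Bernoulli's inequality gives r^n >= n (r - 1), and d^k > k because d >= 2. *)
Lemma expr_escape {F : archiRealFieldType} (d : nat) (r M : F) : (2 <= d)%N -> 1 < r ->
  exists2 k, (0 < k)%N & M < r ^+ (d ^ k).
Proof.
move=> d2 r1; have r0 : 0 < r - 1 by rewrite subr_gt0.
have bernoulli n : n%:R * (r - 1) <= r ^+ n.
  elim: n => [|n IH]; first by rewrite mul0r ler01.
  rewrite -natr1 mulrDl mul1r exprS.
  have -> : r * r ^+ n = r ^+ n + r ^+ n * (r - 1) by ring.
  by rewrite lerD // ler_peMl ?exprn_ege1 ?ltW.
have [k Mk] : exists k : nat, M / (r - 1) < k%:R.
  exists (Num.bound `|M / (r - 1)|).
  exact: le_lt_trans (ler_norm _) (archi_boundP (normr_ge0 _)).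
(* The successor keeps the index positive, since orbits are counted from the first iterate. *)
exists k.+1 => //; apply: lt_le_trans (bernoulli _).
rewrite -ltr_pdivrMr // (lt_trans Mk) // ltr_nat.
exact: ltn_trans (ltnSn k) (ltn_expl _ d2).
Qed.

(** * Chebyshev polynomials in the coordinates s + 1/s and 2 cos a *)

Section Lissajous.
Context {R : realType}.
Local Notation C := (Cplx R).

(** In the coordinate s + 1/s the polynomial acts as s -> s^d, so a d-th root of s yields a
    preimage. *)
Lemma cheby_onto (d : nat) (w : C) : (0 < d)%N ->
  exists x, (chebyT R d).[x] = w.
Proof.
move=> d0; have [s s1 ->] := joukowsky_onto w.
have s0 : s != 0 by rewrite -normr_gt0 (lt_le_trans ltr01).
pose r : C := d.-root s.
have rs : r ^+ d = s by rewrite rootCK.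
have r0 : r != 0 by apply: contra_neq s0 => r0; rewrite -rs r0 expr0n gtn_eqF.
by exists (r + r^-1); rewrite chebyTP // rs.
Qed.

Lemma iter_cheby (d k : nat) (s : C) : s != 0 ->
  iter k (horner (chebyT R d)) (s + s^-1) = s ^+ (d ^ k) + s ^- (d ^ k).
Proof.
move=> s0; elim: k => [|k IH]; first by rewrite expn0 expr1.
by rewrite iterS IH -exprVn exprVn chebyTP ?expf_neq0 // -exprM expnSr.
Qed.

Lemma cheby_cos (d : nat) (a : R) :
  (chebyT R d).[toC (2 * cos a)] = toC (2 * cos (a *+ d)).
Proof.
suff: (chebyT R d).[toC (2 * cos a)] = toC (2 * cos (a *+ d)) /\
  (chebyT R d.+1).[toC (2 * cos a)] = toC (2 * cos (a *+ d.+1)) by case.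
elim: d => [|d [IH1 IH2]].
  by rewrite /= hornerC hornerX mulr0n cos0 mulr1 mulr1n /toC rmorph_nat.
split=> //.
rewrite [chebyT R d.+2]/(_ - _) -/(chebyT R d.+1) -/(chebyT R d).
rewrite hornerD hornerN hornerM hornerX IH1 IH2 /toC -rmorphM -rmorphB.
congr (_%:C)%C.
(* Centred at x = (d+1) a, the recurrence is cos (x + a) + cos (x - a) = 2 cos x cos a. *)
have -> : a *+ d = a *+ d.+1 - a by rewrite mulrSr addrK.
by rewrite cosB (mulrSr a d.+1) cosD; ring.
Qed.

(** * Parametrization of S_P by torus points (a, 1/a, b, 1/b) *)

Lemma esym3_inv_pairs (a b : C) : a != 0 -> b != 0 ->
  let t : {ffun 'I_4 -> C} := [ffun k : 'I_4 => [:: a; a^-1; b; b^-1]`_k] in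
  \prod_k t k = 1 /\
  esym3 t = (a + a^-1 + (b + b^-1), (a + a^-1) * (b + b^-1) + 2, a + a^-1 + (b + b^-1)).
Proof.
move=> a0 b0 t; split.
  by rewrite !big_ord_recl big_ord0 !ffunE /= mulr1; field; rewrite a0 b0.
pose u := a + a^-1; pose v := b + b^-1.
(* The inverse pairs group into the factors X^2 + u X + 1 and X^2 + v X + 1, whose product is
   palindromic. *)
have H : rootp t = Poly [:: 1; u + v; u * v + 2; u + v; 1].
  have E (c : C) : c != 0 ->
      ('X + c%:P) * ('X + c^-1%:P) = 'X ^+ 2 + (c + c^-1)%:P * 'X + 1.
    move=> c0; rewrite mulrDl !mulrDr -polyCM mulfV // polyCD; ring.
  rewrite /rootp !big_ord_recl big_ord0 !ffunE /= mulr1 mulrA !E //.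
  rewrite -/u -/v !cons_poly_def !(polyCD, polyCM); ring.
by rewrite /esym3 !esym_coef // H; rewrite (@PolyK _ 0) //= oner_eq0.
Qed.

(** For inverse pairs the first and third coordinates fed to [FM] coincide, so both a c and (a^2 +
    c^2)/2 become (w + t)^2; this is the source of the equation p^2 = s. *)
Lemma G_P_F_tilde (a b : C) : a != 0 -> b != 0 ->
  let t : {ffun 'I_4 -> C} := [ffun k : 'I_4 => [:: a; a^-1; b; b^-1]`_k] in
  F_tilde (M3inv (esym3 t)) = G_P (a + a^-1) (b + b^-1).
Proof.
move=> a0 b0 t; rewrite (proj2 (esym3_inv_pairs a b a0 b0)) F_tildeE /FM /G_P.
by move: (_ + a^-1) (_ + b^-1) => w u; congr (_, _, _, _); field.
Qed.

Lemma g_map_G_P (d : nat) (w t : C) :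
  g_map d (G_P w t) = G_P (chebyT R d).[w] (chebyT R d).[t].
Proof.
have [a a1 ->] := joukowsky_onto w; have [b b1 ->] := joukowsky_onto t.
have a0 : a != 0 by rewrite -normr_gt0 (lt_le_trans ltr01).
have b0 : b != 0 by rewrite -normr_gt0 (lt_le_trans ltr01).
rewrite -G_P_F_tilde // g_map_F_tilde /f_map M3invK P_A3E; last first.
  by have [] := esym3_inv_pairs a b a0 b0.
rewrite !chebyTP // -!exprVn !exprVn -G_P_F_tilde ?expf_neq0 //.
congr (F_tilde (M3inv (esym3 _))); apply/ffunP => k; rewrite !ffunE.
by case: k => [[|[|[|[|k]]]]] //= _; rewrite exprVn.
Qed.

Lemma G_P_onto : range (fun x : C * C => G_P x.1 x.2) = S_P R.
Proof.
apply/seteqP; split=> [_ [[w t] _ <-] /=|]; first by split; ring.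
move=> [[[p q] r] s] /= [ps qs].
(* Here [v] is the future value of w t + 2. If p = 0 then r = 0 and any square root of q will do;
   otherwise r / p is forced. *)
have [v vq vr] : exists2 v : C, v ^+ 2 = q & p * v = r.
  have [p0|p0] := eqVneq p 0.
    exists (sqrtC q); first by rewrite sqrtCK.
    have /eqP : r ^+ 2 = 0 by rewrite -qs -ps p0; ring.
    by rewrite expf_eq0 /= => /eqP ->; rewrite p0 mul0r.
  exists (r / p); last by rewrite mulrC divfK.
  by rewrite expr_div_n -qs -ps mulfK // expf_neq0.
have [w [t [wt1 wt2]]] := quadratic_roots (sqrtC p) (v - 2).
exists (w, t) => //=; rewrite /G_P wt1 wt2 subrK sqrtCK vq vr -ps.
by rewrite (exprM _ 2 2) sqrtCK.
Qed.

Lemma iter_g_map_G_P (d k : nat) (w t : C) :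
  iter k (g_map d) (G_P w t) =
  G_P (iter k (horner (chebyT R d)) w) (iter k (horner (chebyT R d)) t).
Proof. by elim: k => // k IH; rewrite !iterS IH g_map_G_P. Qed.

(** * Norm estimates for G_P in both directions *)

Lemma G_P_norm_le (w t M : C) : `|w| <= M -> `|t| <= M ->
  `|G_P w t| <= (M + M + M * M + 3) ^+ 4.
Proof.
move=> wM tM; have M0 : 0 <= M := le_trans (normr_ge0 w) wM.
(* [K] dominates 1, [|w + t|] and [|w * t + 2|]; as [K >= 1], its fourth power bounds all four
   coordinates. *)
set K := M + M + M * M + 3.
have K1 : 1 <= K by rewrite /K -[leLHS]add0r lerD ?addr_ge0 ?mulr_ge0 ?ler1n.
have aK : `|w + t| <= K.
  rewrite (le_trans (ler_normD _ _)) // /K -addrA -[leLHS]addr0.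
  by rewrite lerD ?lerD ?addr_ge0 ?mulr_ge0.
have bK : `|w * t + 2| <= K.
  rewrite (le_trans (ler_normD _ _)) // /K normrM -addrA -[leLHS]add0r.
  by rewrite lerD ?addr_ge0 // lerD ?ler_pM // normr_nat ler_nat.
have K0 : 0 <= K := le_trans ler01 K1.
have K24 : K ^+ 2 <= K ^+ 4 by rewrite ler_weXn2l.
have pw n (x : C) : `|x| <= K -> `|x| ^+ n <= K ^+ n.
  by move=> xK; apply: lerXn2r; rewrite ?nnegrE.
have K34 : K ^+ 2 * K <= K ^+ 4 by rewrite -exprSr ler_weXn2l.
rewrite !norm_prod_le /= !(normrX, normrM) (pw 4 _ aK) andbT.
rewrite !(le_trans (pw 2 _ _) K24) //=.
by rewrite (le_trans _ K34) // ler_pM ?pw // exprn_ge0.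
Qed.

(** The first two coordinates alone suffice: they give [|w + t| <= M + 1] and [|w * t| <= M + 3],
    and [quadratic_root_bound] adds these to 1. *)
Lemma G_P_norm_ge (w t M : C) : `|G_P w t| <= M ->
  `|w| <= M + M + 5 /\ `|t| <= M + M + 5.
Proof.
rewrite !norm_prod_le /= => /andP[/andP[/andP[aM bM] _] _].
have sq (x : C) : `|x ^+ 2| <= M -> `|x| <= M + 1.
  rewrite normrX => xM.
  have [x1|/ltW x1] := real_leP (normr_real x) (real1 C).
    by rewrite (le_trans x1) // lerDr (le_trans _ xM) ?exprn_ge0.
  rewrite (le_trans _ (_ : M <= _)) ?lerDl // (le_trans _ xM) //.
  by rewrite expr2 ler_peMl.
move/sq: aM => aM; move/sq: bM => bM.
have cM : `|w * t| <= M + 3.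
  rewrite -[w * t](addrK 2) (le_trans (ler_normB _ _)) // normr_nat.
  by rewrite (_ : M + 3 = M + 1 + 2) ?lerD2r //; ring.
have E : M + M + 5 = 1 + (M + 1) + (M + 3) by ring.
split; first by rewrite E (le_trans (quadratic_root_bound w t)) // lerD ?lerD.
rewrite E (le_trans (quadratic_root_bound t w)) //.
by rewrite [t + w]addrC [t * w]mulrC lerD ?lerD.
Qed.

(** * Bounded Chebyshev orbits and the unit circle *)

Lemma unit_circle_cos (s : C) : `|s| = 1 ->
  exists2 a : R, a \in `[0, 2 * pi]%R & s + s^-1 = toC (2 * cos a).
Proof.
move=> s1; pose x := complex.Re s.
(* On the unit circle the inverse is the conjugate, so the sum is twice the real part. *)
have sx : s + s^-1 = toC (2 * x).
  rewrite invc_norm s1 expr1n invr1 mul1r /toC rmorphM /= ReJ_add rmorph_nat.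
  by field.
have x1 : -1 <= x <= 1.
  rewrite -ler_norml -lecR (le_trans _ (_ : `|s| <= _)) ?s1 //.
  by rewrite -s1 normc_def lecR -sqrtr_sqr ler_wsqrtr // lerDl sqr_ge0.
exists (acos x); last by rewrite acosK // in_itv.
rewrite in_itv /= acos_ge0 //= (le_trans (acos_lepi x1)) //.
by rewrite ler_peMl ?pi_ge0 // ler1n.
Qed.

Lemma bounded_cheby_orbit (d : nat) (w M : C) : (2 <= d)%N ->
  (forall k, (0 < k)%N -> `|iter k (horner (chebyT R d)) w| <= M) ->
  exists2 a : R, a \in `[0, 2 * pi]%R & w = toC (2 * cos a).
Proof.
move=> d2; have [s s1 ->] := joukowsky_onto w => bnd.
have s0 : s != 0 by rewrite -normr_gt0 (lt_le_trans ltr01).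
move: s1; rewrite le_eqVlt => /predU1P[s1|s1]; first exact: unit_circle_cos.
(* [M] is a complex number that bounds a norm, hence nonnegative and real; this allows the
   archimedean argument in [R]. *)
have /complex_realP[m Mm] : M \is Num.real.
  by rewrite ger0_real // (le_trans _ (bnd 1 isT)).
have /complex_realP[r sr] : `|s| \is Num.real by exact: normr_real.
have r1 : 1 < r by rewrite -ltcR -sr.
(* The extra 1 absorbs the term s^(-n), whose modulus is at most 1. *)
have [k k0] := expr_escape d r (m + 1) d2 r1.
rewrite ltNge => /negP[]; have := bnd k k0; rewrite iter_cheby //.
set n := (d ^ k)%N => le_M.
rewrite -lecR rmorphXn rmorphD /= -sr -Mm.
rewrite -normrX -[s ^+ n](addrK (s ^- n)) (le_trans (ler_normB _ _)) // lerD //.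
rewrite normrV ?unitfE ?expf_neq0 // normrX.
by rewrite invf_le1 ?exprn_gt0 ?exprn_ege1 ?ltW // normr_gt0.
Qed.

Lemma iter_cheby_cos_le (d k : nat) (a : R) :
  `|iter k (horner (chebyT R d)) (toC (2 * cos a))| <= 2.
Proof.
elim: k a => [|k IH] a; last by rewrite iterSr cheby_cos IH.
rewrite /= /toC rmorphM normrM rmorph_nat normr_nat ler_piMr //.
by rewrite normc_def /= expr0n addr0 sqrtr_sqr lecR cos_max.
Qed.

End Lissajous.

Theorem theorem4p18 (R : realType) :
  [/\ forall (d : nat) (w t : Cplx R), (0 < d)%N ->
        g_map d (G_P w t) = G_P (chebyT R d).[w] (chebyT R d).[t],
      forall d : nat, (0 < d)%N -> g_map d @` S_P R = S_P R
    & forall d : nat, (2 <= d)%N ->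
        K_set (g_map d) (S_P R) =
        [set G_P (toC (2 * cos a)) (toC (2 * cos b)) |
           a in `[0, 2 * pi] & b in `[0, 2 * pi]] ].
Proof.
split=> [d w t _|d d0|d d2]; first exact: g_map_G_P.
- rewrite -G_P_onto; apply/seteqP; split=> [_ [_ [[w t] _ <-] <-]|_ [[w t] _ <-]].
    by exists ((chebyT R d).[w], (chebyT R d).[t]) => //=; rewrite g_map_G_P.
  have [x xw] := cheby_onto d w d0.
  have [y yt] := cheby_onto d t d0.
  exists (G_P x y); last by rewrite g_map_G_P xw yt.
  by exists (x, y).
- apply/seteqP; split=> [z [Sz bz]|_ [a a_itv [b b_itv <-]]]; last first.
    split; first by rewrite -G_P_onto; exists (toC (2 * cos a), toC (2 * cos b)).
    (* This is the bound of [G_P_norm_le] at M = 2, the bound on all iterates of 2 cos a. *)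
    exists ((2 + 2 + 2 * 2 + 3) ^+ 4); split; first by rewrite realE exprn_ge0.
    move=> M M0 _ [k _ <-]; apply: le_trans (ltW M0).
    by rewrite iter_g_map_G_P G_P_norm_le // iter_cheby_cos_le.
  move: Sz bz; rewrite -G_P_onto => -[[w t] _ <-] /= bz.
  have [M _ bM] := pinfty_ex_gt0 bz.
  have bk k : (0 < k)%N ->
      `|iter k (horner (chebyT R d)) w| <= M + M + 5 /\
      `|iter k (horner (chebyT R d)) t| <= M + M + 5.
    by move=> k0; apply: G_P_norm_ge; rewrite -iter_g_map_G_P; apply: bM; exists k.
  have [a a_itv wa] := bounded_cheby_orbit d w _ d2 (fun k k0 => (bk k k0).1).
  have [b b_itv tb] := bounded_cheby_orbit d t _ d2 (fun k k0 => (bk k k0).2).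
  by exists a => //; exists b => //; rewrite wa tb.
Qed.
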